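(* Let $n\ge 2$, let $F$ be a real algebraic number field of degree $n$ over $\mathbb{Q}$, and let $\psi$ be a quasiperiodic flow on $T^n$ (generated by a constant vector field). If $\psi$ is $F$-algebraic, then $M_\psi$ is a finite index subgroup of $\mathfrak{o}_F^*$.
   Context: $T^n=\mathbb{R}^n/\mathbb{Z}^n$ is the $n$-torus with global coordinates $(\theta_1,\dots,\theta_n)$. For a smooth ($C^\infty$) flow $\psi:\mathbb{R}\times T^n\to T^n$, its generating vector field is $X_\psi(p)=\frac{d}{dt}\psi(t,p)|_{t=0}$. A constant vector field is one of the form $\sum_{i=1}^n a_i\,\partial/\partial\theta_i$ with $a_i\in\mathbb{R}$. A flow generated by a constant vector field is quasiperiodic if the components $a_1,\dots,a_n$ are linearly independent over $\mathbb{Q}$. Generalized symmetry group: $S_\psi$ is the group of all $R\in\mathrm{Diff}(T^n)$ (smooth diffeomorphisms) for which there is $\alpha\in\mathbb{R}^*=\mathbb{R}\setminus\{0\}$ with $R_*X_\psi=\alpha X_\psi$, where $R_*X_\psi=\mathbf{T}R\,X_\psi\,R^{-1}$ is the push-forward and $\mathbf{T}R$ is the derivative map of $R$. The unique such $\alpha$ is the multiplier $\rho_\psi(R)$, and the multiplier group is $M_\psi=\rho_\psi(S_\psi)\subset\mathbb{R}^*$. A real algebraic number field of degree $n$ over $\mathbb{Q}$ is a subfield of $\mathbb{R}$ that is an $n$-dimensional vector space over $\mathbb{Q}$. A quasiperiodic flow $\psi$ on $T^n$ generated by $X_\psi=\sum a_i\,\partial/\partial\theta_i$ is called $F$-algebraic,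 for $F$ such a field of degree $n$, if there is $\vartheta\in\mathbb{R}^*$ such that $\{\vartheta a_1,\dots,\vartheta a_n\}$ is a $\mathbb{Q}$-basis of $F$. $\mathfrak{o}_F$ denotes the ring of algebraic integers in $F$ and $\mathfrak{o}_F^*$ its group of units. *)

(* Defs.v *)
From HB Require Import structures.
From mathcomp Require Import all_boot all_order all_algebra.
From mathcomp Require Import all_classical all_reals all_analysis.

Set Implicit Arguments.
Unset Strict Implicit.
Unset Printing Implicit Defensive.

Import Order.TTheory GRing.Theory Num.Theory.
Import numFieldNormedType.Exports.

Local Open Scope classical_set_scope.
Local Open Scope ring_scope.
Local Open Scope quotient_scope.

(* Between finite-dimensional spaces this is the usual class C^k on an open
   set U: f is differentiable and x |-> 'd f x is of class C^(k-1), the latter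
   being tested on every fixed vector v. *)
Fixpoint class_C (R : realType) (V W : normedModType R) (k : nat)
    (U : set V) (f : V -> W) : Prop :=
  if k is k'.+1 then
    (forall x, U x -> differentiable f x) /\
    (forall v, class_C k' U (fun x => 'd f x v))
  else forall x, U x -> {for x, continuous f}.

Definition smooth_on (R : realType) (V W : normedModType R)
    (U : set V) (f : V -> W) : Prop :=
  forall k, class_C k U f.

Definition integer_lattice (R : realType) (n : nat) : {pred 'rV[R]_n} :=
  [pred x | x \is a mxOver Num.int].

Fact integer_lattice_zmod_closed (R : realType) (n : nat) :
  zmod_closed (@integer_lattice R n).
Proof.
split=> [|x y]; rewrite !inE; first exact: mxOver0 (rpred0 _).
by move=> /mxOverP Zx /mxOverP Zy; apply/mxOverP => i j; rewrite !mxE rpredB.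
Qed.
HB.instance Definition _ (R : realType) (n : nat) :=
  GRing.isZmodClosed.Build 'rV[R]_n (@integer_lattice R n)
    (@integer_lattice_zmod_closed R n).

Definition torus (R : realType) (n : nat) : Type :=
  Quotient.quot (@integer_lattice R n).
HB.instance Definition _ (R : realType) (n : nat) :=
  ZmodQuotient.on (torus R n).

Section Torus.
Variables (R : realType) (n : nat).
Local Notation T := (torus R n).

Definition toT (x : 'rV[R]_n) : T := \pi_T x.

(* The charts of the torus are the local inverses of the projection toT.
   Hence the expression of g : V -> T in a chart around g x is a local lift of
   g through toT. *)
Definition smooth_lift (V : normedModType R) (g : V -> T) (x : V)
    (G : V -> 'rV[R]_n) : Prop :=
  exists U : set V,
    [/\ open_nbhs x U, smooth_on U G & forall y, U y -> toT (G y) = g y].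

Definition smooth_to_torus (V : normedModType R) (g : V -> T) : Prop :=
  forall x, exists G, smooth_lift g x G.

(* The tangent bundle of the torus is trivialized by the global frame
   d/dtheta_1, ..., d/dtheta_n, so tangent vectors are elements of 'rV[R]_n.
   Two smooth lifts of g at x differ by a constant near x, so the choice of the
   lift does not matter. *)
Definition tangent_map (V : normedModType R) (g : V -> T) (x : V) :
    V -> 'rV[R]_n :=
  'd (xget (cst 0) [set G | smooth_lift g x G]) x.

(* Maps defined on the torus are precomposed with the local diffeomorphism
   toT. *)
Definition smooth_map (f : T -> T) : Prop := smooth_to_torus (f \o toT).

Definition derivative_map (f : T -> T) (p : T) : 'rV[R]_n -> 'rV[R]_n :=
  tangent_map (f \o toT) (repr p).

Record diffeo := Diffeo {
  diffeo_fun :> T -> T;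
  diffeo_inv : T -> T;
  diffeo_funK : cancel diffeo_fun diffeo_inv;
  diffeo_invK : cancel diffeo_inv diffeo_fun;
  smooth_diffeo_fun : smooth_map diffeo_fun;
  smooth_diffeo_inv : smooth_map diffeo_inv }.

Definition vector_field : Type := T -> 'rV[R]_n.

Definition pushforward (f : diffeo) (X : vector_field) : vector_field :=
  fun p => derivative_map f (diffeo_inv f p) (X (diffeo_inv f p)).

Definition smooth_flow (psi : R -> T -> T) : Prop :=
  [/\ smooth_to_torus (fun z : R^o * 'rV[R]_n => psi z.1 (toT z.2)),
      forall p, psi 0 p = p &
      forall s t p, psi (s + t) p = psi s (psi t p)].

Definition generator (psi : R -> T -> T) : vector_field :=
  fun p => tangent_map (fun t : R^o => psi t p) 0 1.

Definition symmetry_group (psi : R -> T -> T) : set diffeo :=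
  [set f | exists alpha : R, alpha != 0 /\
    forall p, pushforward f (generator psi) p = alpha *: generator psi p].

Definition multiplier (psi : R -> T -> T) (f : diffeo) : R :=
  xget 0 [set alpha : R | alpha != 0 /\
    forall p, pushforward f (generator psi) p = alpha *: generator psi p].

Definition multiplier_group (psi : R -> T -> T) : set R :=
  multiplier psi @` symmetry_group psi.

End Torus.

Section Algebra.
Variables (R : realType) (n : nat).

Definition rat_free (b : 'I_n -> R) : Prop :=
  forall q : 'I_n -> rat, \sum_i ratr (q i) * b i = 0 -> forall i, q i = 0.

Definition rat_basis (F : {pred R}) (b : 'I_n -> R) : Prop :=
  [/\ forall i, b i \in F,
      rat_free b &
      forall x, x \in F ->
        exists q : 'I_n -> rat, x = \sum_i ratr (q i) * b i].

End Algebra.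

Definition has_degree (R : realType) (F : {pred R}) (n : nat) : Prop :=
  exists b : 'I_n -> R, rat_basis F b.

Definition ring_of_integers (R : realType) (F : {pred R}) : set R :=
  [set x | x \in F /\ integralOver (intr : int -> R) x].

Definition unit_group (R : realType) (A : set R) : set R :=
  [set x | A x /\ exists2 y, A y & x * y = 1].

Definition finite_index_subgroup (R : realType) (M G : set R) : Prop :=
  [/\ M `<=` G, M 1,
      forall x y, M x -> M y -> M (x / y) &
      finite_set [set [set g * m | m in M] | g in G]].

Section Flows.
Variables (R : realType) (n : nat).

Definition quasiperiodic (psi : R -> torus R n -> torus R n) : Prop :=
  smooth_flow psi /\
  exists a : 'rV[R]_n,
    (forall p, generator psi p = a) /\ rat_free (fun i => a 0 i).

Definition algebraic_flow (F : {pred R})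
    (psi : R -> torus R n -> torus R n) : Prop :=
  exists a : 'rV[R]_n,
    (forall p, generator psi p = a) /\
    exists theta : R, theta != 0 /\ rat_basis F (fun i => theta * a 0 i).

End Flows.

(* Main.v *)
(* If [f] is in the symmetry group with multiplier [al], then [f] conjugates
   the linear flow of [a] to that of [al *: a], because the derivative of [f]
   sends [a] to [al *: a] everywhere.  A lift [G] of [f] to R^n is at bounded
   distance from a linear map [B] preserving Z^n, and [G (t *: a)] is
   [G 0 + (t * al) *: a]; comparing slopes gives [al *: a = a *m B].  The same
   argument for the inverse of [f], and the linear diffeomorphism of the torus
   attached to an invertible integer matrix, show that the multiplier group is
   the group of the nonzero [al] such that [al] and [al^-1] both map the lattice
   spanned by the components of [a] into itself.
   After rescaling, these components are a Q-basis of F.  Nondegeneracy of the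
   trace form bounds the denominators of the matrices of multiplication by
   algebraic integers by some [d]; two units whose matrices, multiplied by [d],
   agree modulo [d ^ 2] then have a quotient that stabilizes the lattice, and
   there are finitely many such residues. *)
Require Import Defs.
From mathcomp Require Import all_boot all_order all_algebra all_field.
From mathcomp Require Import all_classical all_reals all_analysis.
From mathcomp Require Import lra.

Set Implicit Arguments.
Unset Strict Implicit.
Unset Printing Implicit Defensive.

Import Order.TTheory GRing.Theory Num.Theory.
Import numFieldNormedType.Exports.

Local Open Scope classical_set_scope.
Local Open Scope ring_scope.
Local Open Scope quotient_scope.

(** * Lifting torus maps *)

Section TorusProjection.
Variables (R : realType) (n : nat).
Implicit Types (x y : 'rV[R]_n).
Local Notation toT := (@toT R n).

Lemma toT_eq x y : (toT x = toT y) <-> (x - y \is a mxOver Num.int).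
Proof.
split=> [/eqP|].
  by rewrite /toT; move/eqP/eqP; rewrite eqmodE /= /Quotient.equiv.
by move=> h; apply/eqP; rewrite /toT; rewrite eqmodE /= /Quotient.equiv.
Qed.

Lemma toTD x y : toT (x + y) = toT x + toT y.
Proof. exact: raddfD. Qed.

Lemma toTB x y : toT (x - y) = toT x - toT y.
Proof. exact: raddfB. Qed.

Lemma toT0 : toT 0 = 0.
Proof. exact: raddf0. Qed.

Lemma toT_repr (p : torus R n) : toT (repr p) = p.
Proof. exact: reprK. Qed.

Lemma toT_eq0 x : toT x = 0 <-> x \is a mxOver Num.int.
Proof. by rewrite -toT0 toT_eq subr0. Qed.

Lemma coord_le_norm x i : `|x 0 i| <= `|x|.
Proof.
rewrite [`|x|]mx_normrE.
by apply: (le_trans _ (le_bigmax _ _ (ord0, i))); rewrite ord1.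
Qed.

Lemma int_small_eq0 x : x \is a mxOver Num.int -> `|x| < 1 -> x = 0.
Proof.
move=> /mxOverP xZ x1; apply/rowP => i; rewrite mxE; apply/eqP/negP => /negP xi.
by have := norm_intr_ge1 (xZ 0 i) xi; rewrite leNgt (le_lt_trans (coord_le_norm _ _)).
Qed.

(** A nonzero integer vector has sup norm at least 1. This is what turns identities in the torus
    into identities in the covering space below. *)
Lemma toT_small_inj x y : toT x = toT y -> `|x - y| < 1 -> x = y.
Proof. by move=> /toT_eq xy /(int_small_eq0 xy)/subr0_eq. Qed.

End TorusProjection.

Lemma natr_truncn_gt (R : realType) (x : R) : 0 <= x -> x < (Num.truncn x).+1%:R.
Proof. by move=> x0; case/andP: (truncn_itv x0). Qed.

Lemma natmul_gt (R : realType) (x d : R) : 0 < d -> 0 <= x ->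
  x < (Num.truncn (x / d)).+1%:R * d.
Proof. by move=> d0 x0; rewrite -ltr_pdivrMr// natr_truncn_gt// divr_ge0// ltW. Qed.

(** * Chains of short steps along segments *)

Section Subdivision.
Variables (R : realType) (V : normedModType R).
Implicit Types (x y : V) (i N : nat).

Definition subdiv N i x : V := (i%:R / N%:R) *: x.

Lemma subdiv0 N x : subdiv N 0 x = 0.
Proof. by rewrite /subdiv mul0r scale0r. Qed.

Lemma subdiv_zero N i : subdiv N i 0 = 0.
Proof. by rewrite /subdiv scaler0. Qed.

Lemma subdivNN N x : (0 < N)%N -> subdiv N N x = x.
Proof. by move=> N0; rewrite /subdiv divff ?scale1r// pnatr_eq0 -lt0n. Qed.

Lemma subdivS_close N i x d : `|x| < N%:R * d -> (0 < N)%N ->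
  `|subdiv N i.+1 x - subdiv N i x| < d.
Proof.
move=> xd N0; rewrite /subdiv -scalerBl -mulrBl -natrB// subSnn mul1r.
by rewrite normrZ normfV normr_nat ltr_pdivrMl// ltr0n.
Qed.

Lemma subdiv_close N i x y d : `|y - x| < d -> (i <= N)%N ->
  `|subdiv N i y - subdiv N i x| < d.
Proof.
move=> xd N0; rewrite /subdiv -scalerBr normrZ (le_lt_trans _ xd)//.
rewrite ger0_norm ?divr_ge0// ler_piMl//.
case: N N0 => [|N] N0; first by rewrite invr0 mulr0.
by rewrite ler_pdivrMr ?ltr0n// mul1r ler_nat.
Qed.

Lemma subdiv_norm N i x d : `|x| < d -> (i <= N)%N -> `|subdiv N i x| < d.
Proof.
move=> xd iN; have := @subdiv_close N i 0 x d.
by rewrite /subdiv scaler0 !subr0; exact.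
Qed.

(** The segment from 0 to [x] is cut into steps shorter than [d], and [E] does not change along any
    of them. *)
Lemma chain_const (T : Type) (E : V -> T) d : 0 < d ->
  (forall x y, `|y - x| < d -> E y = E x) -> forall x, E x = E 0.
Proof.
move=> d0 Ed x; set N := (Num.truncn (`|x| / d)).+1.
have xN : `|x| < N%:R * d by exact: natmul_gt.
rewrite -[in LHS](@subdivNN N x)//; move: {2}N => i; elim: i => [|i <-].
  by rewrite subdiv0.
by apply: Ed; exact: subdivS_close.
Qed.

(** The same walk from 0 to [x], each of the [N] steps costing less than [c]. *)
Lemma chain_bound (W : normedModType R) (E : V -> W) (d c : R) (N : nat) :
  (forall x y, `|y - x| < d -> `|E y - E x| < c) ->
  forall x, `|x| < N%:R * d -> E 0 = 0 -> `|E x| <= N%:R * c.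
Proof.
move=> Ed x xN E0.
have N0 : (0 < N)%N by case: N xN => //; rewrite mul0r normr_lt0.
rewrite -[in leLHS](@subdivNN N x)//.
suff H i : `|E (subdiv N i x)| <= i%:R * c by exact: H.
elim: i => [|i IH]; first by rewrite subdiv0 E0 normr0 mul0r.
rewrite -(subrK (E (subdiv N i x)) (E _)) (le_trans (ler_normD _ _))//.
rewrite -natr1 mulrDl mul1r addrC lerD// ltW//.
by apply: Ed; exact: subdivS_close.
Qed.

End Subdivision.

Lemma subr_swap (V : zmodType) (a b c d : V) : a - b = c - d -> a - c = b - d.
Proof.
move=> /eqP; rewrite subr_eq => /eqP ->.
by rewrite addrAC [c - d - c]addrAC subrr add0r addrC.
Qed.

(** * Global lifts of periodic maps and their linear part *)

Section GlobalLift.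
Variables (R : realType) (n : nat).
Local Notation toT := (@toT R n).

(** Continuity is phrased by short displacement vectors, so that no topology on the quotient
    enters. *)
Definition torus_continuous (phi : 'rV[R]_n -> torus R n) :=
  forall x (e : R), 0 < e ->
    \forall y \near x, exists2 v, `|v| < e & phi y = phi x + toT v.

Definition lattice_periodic (phi : 'rV[R]_n -> torus R n) :=
  forall x k, k \is a mxOver Num.int -> phi (x + k) = phi x.

Lemma cube_compact : compact [set x : 'rV[R]_n | forall i, `[(0:R), 1]%classic (x 0 i)].
Proof.
exact: (@rV_compact R n (fun=> `[0, 1]%classic) (fun=> @segment_compact R 0 1)).
Qed.

Definition floor_row (x : 'rV[R]_n) : 'rV[R]_n := map_mx (fun t => (Num.floor t)%:~R) x.

Lemma floor_row_int x : floor_row x \is a mxOver Num.int.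
Proof. by apply/mxOverP => i j; rewrite mxE intr_int. Qed.

Lemma frac_row_cube x i : `[(0:R), 1]%classic ((x - floor_row x) 0 i).
Proof.
rewrite /= in_itv/= !mxE subr_ge0 floor_le lerBlDl -lerBlDr.
by have /ltW := floorD1_gt (x 0 i); rewrite intrD lerBlDr.
Qed.

(** Uniform continuity on the compact unit cube, spread to the whole space by periodicity. *)
Lemma periodic_uniform phi : torus_continuous phi -> lattice_periodic phi ->
  exists2 d : R, 0 < d & forall x y, `|y - x| < d ->
    exists2 v, `|v| < 4^-1 & phi y = phi x + toT v.
Proof.
move=> cphi pphi.
have /compact_near_coveringP cov := cube_compact.
have [x _|d /= d0 H] := cov R (0^'+)
    (fun d x => forall y, `|y - x| < d ->
      exists2 v, `|v| < 4^-1 & phi y = phi x + toT v) _.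
  (* Two displacements from the centre [x] are subtracted, so each is kept below 1/8 to end below
     1/4. *)
  have /cphi : 0 < (8 : R)^-1 by rewrite invr_gt0.
  move=> /(_ x)/nbhs_ballP[r/= r0 Hr].
  have r20 : 0 < r / 2 by rewrite divr_gt0.
  near=> x' d => y yd.
  have x'x : `|x - x'| < r / 2.
    by near: x'; apply/nbhs_ballP; exists (r / 2) => // z; rewrite -ball_normE.
  have dr : d < r / 2 by near: d; exact: nbhs_right_lt.
  have [|v' v'8 ex'] := Hr x'.
    by rewrite -ball_normE/= (lt_trans x'x)// ltr_pdivrMr// ltr_pMr// ltr1n.
  have [|v v8 ey] := Hr y.
    rewrite -ball_normE/= -(subrKA x' x) (le_lt_trans (ler_normD _ _))//.
    by rewrite (splitr r) ltrD// distrC (lt_trans yd).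
  exists (v - v'); first by rewrite (le_lt_trans (ler_normB _ _))//; lra.
  by rewrite ey ex' toTB -addrA; congr (_ + _); rewrite addrC subrK.
have d20 : 0 < d / 2 by rewrite divr_gt0.
have {}H := H (d / 2) _ d20.
exists (d / 2) => // x y xy.
(* Both points are translated by the floor of [x]: this keeps [y - x], and only the base point has
   to land in the cube. *)
have px z : phi z = phi (z - floor_row x).
  by rewrite -(pphi (z - _) (floor_row x)) ?subrK// floor_row_int.
rewrite (px x) (px y).
apply: H.
- by rewrite /= sub0r normrN gtr0_norm// ltr_pdivrMr// ltr_pMr// ltr1n.
- by move=> i; exact: frac_row_cube.
- by rewrite opprB addrA subrK.
Unshelve. all: by end_near. Qed.

(** [G x] adds up the short displacements of [phi] along a fine subdivision of the segment from 0 to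
    [x]; the work is to show that the fineness does not matter. *)
Lemma global_lift phi : torus_continuous phi -> lattice_periodic phi ->
  exists2 G : 'rV[R]_n -> 'rV[R]_n, G 0 = 0 &
  exists2 d : R, 0 < d & forall x y, `|y - x| < d ->
    `|G y - G x| < 4^-1 /\ phi y = phi x + toT (G y - G x).
Proof.
move=> cphi pphi; have [d d0 dphi] := periodic_uniform cphi pphi.
pose D x y := xget 0 [set v | `|v| < 4^-1 /\ phi y = phi x + toT v].
have DP x y : `|y - x| < d -> `|D x y| < 4^-1 /\ phi y = phi x + toT (D x y).
  move=> /dphi[v v4 yx].
  by apply: (@xgetPex _ 0 [set v | `|v| < 4^-1 /\ phi y = phi x + toT v]); exists v.
have D0 x : D x x = 0.
  have [|x4 xx] := DP x x; first by rewrite subrr normr0.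
  apply: (@toT_small_inj R n); last by rewrite subr0; lra.
  by rewrite toT0; apply: (@addrI _ (phi x)); rewrite -xx addr0.
(* Around a small quadrilateral the displacements have an integer alternating sum; four terms below
   1/4 keep it below 1, so it vanishes. *)
have Dsq x x' y y' : `|x' - x| < d -> `|y' - y| < d -> `|y - x| < d -> `|y' - x'| < d ->
    D x y + D y y' - D x x' = D x' y'.
  move=> /DP[b1 e1] /DP[b2 e2] /DP[b3 e3] /DP[b4 e4].
  apply: (@toT_small_inj R n).
    rewrite toTB toTD; apply: (@addrI _ (phi x')); rewrite -e4 e2 e3 e1.
    by rewrite -addrA [X in _ + X = _]addrC subrK addrA.
  rewrite (le_lt_trans (ler_normB _ _))//.
  have h1 := ler_normB (D x y + D y y') (D x x').
  have h2 := ler_normD (D x y) (D y y').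
  lra.
pose S N x := \sum_(0 <= i < N) D (subdiv N i x) (subdiv N i.+1 x).
have S0 N : S N 0 = 0 by rewrite /S big1// => i _; rewrite !subdiv_zero D0.
(* The strip between the two segments is cut into small quadrilaterals, whose relations are
   summed. *)
have SD N x y : `|x| < N%:R * d -> `|y| < N%:R * d -> `|y - x| < d ->
    S N y - S N x = D x y.
  move=> xN yN xy.
  have N0 : (0 < N)%N by case: N xN {yN} => //; rewrite mul0r normr_lt0.
  suff H j : (j <= N)%N -> \sum_(0 <= i < j) D (subdiv N i y) (subdiv N i.+1 y) -
      \sum_(0 <= i < j) D (subdiv N i x) (subdiv N i.+1 x) =
      D (subdiv N j x) (subdiv N j y).
    by rewrite /S H// !subdivNN.
  elim: j => [_|j IH jN]; first by rewrite !big_geq// !subdiv0 D0 subrr.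
  rewrite !big_nat_recr//= opprD addrACA IH; last exact: ltnW.
  rewrite addrA; apply: Dsq; [exact: subdivS_close|exact: subdivS_close| |].
    by apply: subdiv_close => //; exact: ltnW.
  exact: subdiv_close.
(* Telescoping [S M] along the subdivision into [N] steps: by [SD] each increment is the
   displacement that [S N] adds. *)
have SS M N x : `|x| < M%:R * d -> `|x| < N%:R * d -> S M x = S N x.
  move=> xM xN.
  have N0 : (0 < N)%N by case: N xN => //; rewrite mul0r normr_lt0.
  have := telescope_sumr (fun i => S M (subdiv N i x)) (leq0n N).
  rewrite subdiv0 S0 subr0 subdivNN// => <-.
  apply: eq_big_nat => i /andP[_ iN]; apply: SD.
  - by apply: subdiv_norm => //; exact: ltnW.
  - exact: subdiv_norm.
  - exact: subdivS_close.
pose N (x : 'rV[R]_n) := (Num.truncn (`|x| / d)).+1.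
have NP x : `|x| < (N x)%:R * d by exact: natmul_gt.
exists (fun x => S (N x) x); first exact: S0.
exists d => // x y xy.
suff -> : S (N y) y - S (N x) x = D x y by exact: DP.
have lex z m : (N z <= m)%N -> `|z| < m%:R * d.
  by move=> zm; rewrite (lt_le_trans (NP z))// ler_pM2r// ler_nat.
rewrite (SS (N y) (maxn (N x) (N y)))//; last by apply: lex; rewrite leq_maxr.
rewrite (SS (N x) (maxn (N x) (N y)))//; last by apply: lex; rewrite leq_maxl.
by apply: SD => //; apply: lex; rewrite ?leq_maxr ?leq_maxl.
Qed.

Lemma norm_frac_row (x : 'rV[R]_n) : `|x - floor_row x| <= 1.
Proof.
rewrite [leLHS]mx_normrE; apply: bigmax_le => // -[i j] _ /=; rewrite ord1.
by have := frac_row_cube x j; rewrite /= in_itv/= => /andP[x0 x1]; rewrite ger0_norm.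
Qed.

Lemma bounded_eq0 (x : 'rV[R]_n) (c : R) : (forall t : R, `|t *: x| <= c) -> x = 0.
Proof.
move=> xc; apply/eqP/negP => /negP; rewrite -normr_gt0 => x0.
have := xc ((`|c| + 1) / `|x|); rewrite normrZ normrM normfV normr_id.
rewrite divfK ?gt_eqF// ger0_norm ?addr_ge0//.
by have := ler_norm c; lra.
Qed.

Lemma norm_mulmx_le (x : 'rV[R]_n) (B : 'M[R]_n) :
  `|x *m B| <= `|x| * (\sum_i \sum_j `|B i j|).
Proof.
rewrite [leLHS]mx_normrE; apply: bigmax_le => [|[i j] _ /=].
  by rewrite mulr_ge0// sumr_ge0// => i _; rewrite sumr_ge0.
rewrite ord1 mxE mulr_sumr (le_trans (ler_norm_sum _ _ _))//.
apply: ler_sum => k _; rewrite normrM ler_pM// ?coord_le_norm//.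
by rewrite (bigD1 j)//= lerDl sumr_ge0.
Qed.

Lemma global_lift_linear phi : torus_continuous phi -> lattice_periodic phi ->
  exists G : 'rV[R]_n -> 'rV[R]_n, exists d : R, exists B : 'M[R]_n, exists c : R,
  [/\ 0 < d, G 0 = 0,
    forall x y, `|y - x| < d ->
      `|G y - G x| < 4^-1 /\ phi y = phi x + toT (G y - G x),
    forall x, phi x = phi 0 + toT (G x) &
    B \is a mxOver Num.int /\ forall x, `|G x - x *m B| <= c].
Proof.
move=> cphi pphi; have [G G0 [d d0 Gd]] := global_lift cphi pphi.
(* By periodicity, [G] lifts the same increments near [x] and near [x + k], so [G (x + k) - G x] is
   locally constant in [x]. *)
have Gk k x : k \is a mxOver Num.int -> G (x + k) = G x + G k.
  move=> kZ; apply/eqP; rewrite [X in _ == X]addrC -subr_eq; apply/eqP.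
  suff -> : G (x + k) - G x = G (0 + k) - G 0 by rewrite add0r G0 subr0.
  apply: (@chain_const R _ _ (fun x => G (x + k) - G x) d d0).
  move=> {}x y xy; apply: subr_swap.
  have [|n1 e1] := Gd (x + k) (y + k); first by rewrite opprD addrACA subrr addr0.
  have [n2 e2] := Gd x y xy.
  apply: (@toT_small_inj R n).
    by apply: (@addrI _ (phi x)); rewrite -e2 -(pphi x k kZ) -e1 pphi.
  by rewrite (le_lt_trans (ler_normB _ _))//; lra.
have phiG x : phi x = phi 0 + toT (G x).
  apply/eqP; rewrite -subr_eq; apply/eqP.
  suff -> : phi x - toT (G x) = phi 0 - toT (G 0) by rewrite G0 toT0 subr0.
  apply: (@chain_const R _ _ (fun x => phi x - toT (G x)) d d0).
  move=> {}x y /Gd[_ ->]; rewrite toTB -addrA; congr (_ + _).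
  by rewrite addrAC subrr add0r.
have intD (k l : 'rV[R]_n) : k \is a mxOver Num.int -> l \is a mxOver Num.int ->
    k + l \is a mxOver Num.int by exact: (@rpredD _ (@integer_lattice R n)).
have Gn k m : k \is a mxOver Num.int -> G (k *+ m) = G k *+ m.
  by move=> kZ; elim: m => [|m IH]; rewrite ?mulr0n// !mulrSr Gk// IH.
have Gz k (z : int) : k \is a mxOver Num.int -> G (k *~ z) = G k *~ z.
  move=> kZ; case: z => m; first exact: Gn.
  apply/eqP; rewrite NegzE !mulrNz -addr_eq0 -[G k *~ _](Gn k m.+1 kZ).
  by rewrite -Gk ?(@rpredMn _ (@integer_lattice R n))// addNr G0.
have eZ (i : 'I_n) : (delta_mx 0 i : 'rV[R]_n) \is a mxOver Num.int.
  by apply/mxOverP => a b; rewrite mxE; case: andP.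
(* [G] is additive on the lattice, hence given there by its values on the standard basis. *)
pose B : 'M[R]_n := \matrix_i G (delta_mx 0 i).
have GB k : k \is a mxOver Num.int -> G k = k *m B.
  move=> kZ; rewrite mulmx_sum_row [in LHS](row_sum_delta k).
  have kiZ i : k 0 i *: delta_mx 0 i \is a @mxOver 1 n _ Num.int.
    have /mxOverP/(_ 0 i)/intrP[z ->] := kZ.
    by rewrite scaler_int (@rpredMz _ (@integer_lattice R n)).
  have kiE i : G (k 0 i *: delta_mx 0 i) = k 0 i *: row i B.
    have /mxOverP/(_ 0 i)/intrP[z ->] := kZ.
    by rewrite !scaler_int Gz// rowK.
  elim: (index_enum _) => [|i s IH]; first by rewrite !big_nil.
  by rewrite !big_cons addrC Gk// IH kiE addrC.
have BZ : B \is a mxOver Num.int.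
  apply/mxOverP => i j.
  have /toT_eq0/mxOverP/(_ 0 j) : toT (G (delta_mx 0 i)) = 0; last by rewrite mxE.
  apply: (@addrI _ (phi 0)).
  by rewrite -phiG addr0 -[in LHS](add0r (delta_mx 0 i)) pphi.
exists G, d, B; set C := \sum_i \sum_j `|B i j|.
pose N := (Num.truncn (1 / d)).+1.
exists (N%:R * 4^-1 + C); split => //; split => // x.
(* [G] and [B] agree on lattice vectors, so their difference depends only on the fractional part of
   [x]; [N] steps shorter than [d] reach it from 0 and bound [G] there. *)
have -> : G x = G (x - floor_row x) + floor_row x *m B.
  by rewrite -GB ?floor_row_int// -Gk ?floor_row_int// subrK.
have -> : x *m B = (x - floor_row x) *m B + floor_row x *m B by rewrite -mulmxDl subrK.
rewrite opprD addrACA subrr addr0.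
rewrite (le_trans (ler_normB _ _))// lerD//.
  apply: (@chain_bound _ _ _ _ d) => //; first by move=> u v /Gd[].
  by rewrite (le_lt_trans (norm_frac_row x))//; exact: natmul_gt.
rewrite (le_trans (norm_mulmx_le _ _))// ler_piMl ?norm_frac_row//.
by rewrite sumr_ge0// => i _; rewrite sumr_ge0.
Qed.

(** Along the line of [a], the global lift and the linear motion lift the same path and agree at 0,
    hence everywhere. All multiples of [al *: a - a *m B] are then bounded. *)
Lemma multiplier_matrix phi (a : 'rV[R]_n) (al : R) :
  torus_continuous phi -> lattice_periodic phi ->
  (forall t : R, phi (t *: a) = phi 0 + toT ((t * al) *: a)) ->
  exists2 B : 'M[R]_n, B \is a mxOver Num.int & al *: a = a *m B.
Proof.
move=> cphi pphi phia.
have [G [d [B [c [d0 G0 Gd phiG [BZ Bc]]]]]] := global_lift_linear cphi pphi.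
exists B => //; apply/subr0_eq/(@bounded_eq0 _ c) => t.
suff Ga : G (t *: a) = (t * al) *: a.
  by rewrite scalerBr scalerA -Ga scalemxAl.
pose M := `|a| + `|al *: a| + 1.
have M0 : 0 < M by rewrite ltr_wpDl// addr_ge0.
have aM : `|a| <= M by rewrite /M -addrA lerDl addr_ge0.
have alM : `|al *: a| <= M by rewrite /M addrAC lerDr addr_ge0.
(* The bound [d] controls the increment of [G] by 1/4; with 1/2 for the linear motion, the
   difference stays below 1. *)
pose m := Num.min d 2^-1.
have m0 : 0 < m by rewrite lt_min d0 invr_gt0/=.
apply/subr0_eq.
suff -> : G (t *: a) - (t * al) *: a = G ((0 : R) *: a) - (0 * al) *: a.
  by rewrite mul0r !scale0r G0 subrr.
apply: (@chain_const R R^o _ (fun t => G (t *: a) - (t * al) *: a) (m / M)).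
  by rewrite divr_gt0.
move=> u v; rewrite ltr_pdivlMr// => uv.
have b (w : 'rV[R]_n) : `|w| <= M -> `|(v - u) *: w| < m.
  by move=> wM; rewrite normrZ (le_lt_trans _ uv)// ler_wpM2l.
have [|h1 h2] := Gd (u *: a) (v *: a).
  by rewrite -scalerBl (lt_le_trans (b _ aM))// ge_min lexx.
have := b _ alM; rewrite lt_min => /andP[_ h3].
rewrite -!scalerA; apply: subr_swap; rewrite -scalerBl.
apply: (@toT_small_inj R n).
  apply: (@addrI _ (phi (u *: a))); rewrite -h2 !phia.
  by rewrite scalerBl toTB !scalerA -addrA; congr (_ + _); rewrite addrC subrK.
by rewrite (le_lt_trans (ler_normB _ _))//; lra.
Qed.

End GlobalLift.

(** * Smooth maps and the symmetry group *)

(** A directional derivative only sees the increments of the function, so it survives translations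
    of source and target and restriction to a line. *)
Lemma is_derive_increments (R : realType) (V1 V2 W : normedModType R)
    (f : V1 -> W) (g : V2 -> W) a v b w l :
  (forall h : R, f (h *: v + a) - f a = g (h *: w + b) - g b) ->
  is_derive a v f l -> is_derive b w g l.
Proof.
move=> fg [dfa <-].
have E : (fun h : R => h^-1 *: ((g \o shift b) (h *: w) - g b)) =
         (fun h : R => h^-1 *: ((f \o shift a) (h *: v) - f a)).
  by apply/funext => h /=; rewrite fg.
by apply: DeriveDef; rewrite /derivable/derive E.
Qed.

(** * Derivatives through local lifts *)

Section LocalLifts.
Variables (R : realType) (n : nat).
Local Notation toT := (@toT R n).
Implicit Types (x y v : 'rV[R]_n) (g : 'rV[R]_n -> torus R n).

Lemma smooth_lift_differentiable g x G : smooth_lift g x G -> differentiable G x.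
Proof. by move=> [U [[_ Ux] /(_ 1)[GU _] _]]; exact: GU. Qed.

Lemma smooth_lift_is_derive g x G v : smooth_lift g x G -> is_derive x v G ('d G x v).
Proof.
move=> /smooth_lift_differentiable dG.
by apply: DeriveDef; [exact: diff_derivable|exact: deriveE].
Qed.

Lemma smooth_lift_ball g x G (e : R) : smooth_lift g x G -> 0 < e ->
  exists2 r : R, 0 < r & forall z, `|z| < r ->
    `|G (z + x) - G x| < e /\ toT (G (z + x)) = g (z + x).
Proof.
move=> [U [[oU Ux] /(_ 0)/= GU Ug]] e0.
have /cvgrPdist_lt/(_ _ e0) := GU _ Ux.
move=> /(filterI (open_nbhs_nbhs (conj oU Ux)))/nbhs_ballP[r r0 Hr].
exists r => // z zr; have /Hr[Uz Gz] : ball x r (z + x).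
  by rewrite -ball_normE/= opprD addrCA subrr addr0 normrN.
by split; [rewrite distrC|exact: Ug].
Qed.

Lemma smooth_to_torus_continuous g : smooth_to_torus g -> torus_continuous g.
Proof.
move=> sg x e e0; have [G sG] := sg x.
have [r r0 Hr] := smooth_lift_ball sG e0.
have [|_ gx] := Hr 0; first by rewrite normr0.
rewrite add0r in gx.
apply/nbhs_ballP; exists r => // y; rewrite -ball_normE/= => xy.
have [|h1 h2] := Hr (y - x); first by rewrite distrC.
rewrite subrK in h1 h2; exists (G y - G x) => //.
by rewrite toTB h2 gx addrC subrK.
Qed.

(** Near the base points both lifts move by less than 1/2; once their values there are matched, they
    agree in the torus and differ by less than 1. *)
Lemma lift_near_translate g g' x y G H : smooth_lift g x G -> smooth_lift g' y H ->
  (forall z, g (z + x) = g' (z + y)) ->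
  \forall w \near y, G (w - y + x) + (H y - G x) = H w.
Proof.
move=> sG sH gg'; have h0 : (0 : R) < 2^-1 by rewrite invr_gt0.
have [r r0 Hr] := smooth_lift_ball sG h0.
have [s s0 Hs] := smooth_lift_ball sH h0.
apply/nbhs_ballP; exists (Num.min r s); first by rewrite /= lt_min r0.
move=> w; rewrite -ball_normE/= distrC lt_min => /andP[/Hr[r1 r2] /Hs[]].
rewrite subrK => s1 s2.
have [|_ Gx] := Hr 0; first by rewrite normr0.
have [|_ Hy] := Hs 0; first by rewrite normr0.
rewrite add0r in Gx; rewrite add0r in Hy.
have gxy := gg' 0; rewrite !add0r in gxy.
apply: (@toT_small_inj R n).
  by rewrite toTD toTB r2 Gx Hy gxy subrr addr0 gg' subrK s2.
have -> : G (w - y + x) + (H y - G x) - H w = (G (w - y + x) - G x) - (H w - H y).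
  by rewrite opprB addrCA addrAC addrC.
by rewrite (le_lt_trans (ler_normB _ _))//; lra.
Qed.

(** Frees the derivative from the lift picked by [xget]; allowing two base points also frees it from
    the representative of the point of the torus. *)
Lemma lift_diff g g' x y G H v : smooth_lift g x G -> smooth_lift g' y H ->
  (forall z, g (z + x) = g' (z + y)) -> 'd G x v = 'd H y v.
Proof.
move=> sG sH gg'; 
have dG := smooth_lift_is_derive v sG; have dH := smooth_lift_is_derive v sH.
suff dGy : is_derive y v (fun w => G (w - y + x) + (H y - G x)) ('d G x v).
  have e1 := near_eq_derive v (lift_near_translate sG sH gg').
  have e2 : 'D_v H y = 'd H y v by case: dH.
  have e3 : 'D_v (fun w => G (w - y + x) + (H y - G x)) y = 'd G x v by case: dGy.
  have e4 : 'D_v H y = 'd G x v by rewrite -e1.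
  exact: etrans (esym e4) e2.
apply: is_derive_increments dG => h.
by rewrite addrK subrr add0r opprD addrACA subrr addr0.
Qed.

Lemma derivative_mapE (f : torus R n -> torus R n) x H v : smooth_map f ->
  smooth_lift (f \o toT) x H -> derivative_map f (toT x) v = 'd H x v.
Proof.
move=> sf sH; apply: (@lift_diff (f \o toT) (f \o toT) (repr (toT x)) x) => //.
  exact: (xgetPex _ (sf _)).
by move=> z /=; rewrite !toTD toT_repr.
Qed.

(** The global lift of [f] has constant derivative [al *: a] along each line of direction [a], so it
    is affine on that line. *)
Lemma flow_conjugacy (f : torus R n -> torus R n) (a : 'rV[R]_n) (al : R) :
  smooth_map f -> (forall p, derivative_map f p a = al *: a) ->
  forall p t, f (p + toT (t *: a)) = f p + toT ((t * al) *: a).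
Proof.
move=> sf df p t; set phi := f \o toT.
have cphi : torus_continuous phi by exact: smooth_to_torus_continuous.
have pphi : lattice_periodic phi.
  by move=> x k /toT_eq0 k0; rewrite /phi/= toTD k0 addr0.
have [G [d [B [c [d0 G0 Gd phiG _]]]]] := global_lift_linear cphi pphi.
(* [G] comes from continuity alone; near [x] it differs by a constant from a smooth local lift [H],
   which gives its derivative. *)
have dG x : is_derive x a G (al *: a).
  have [H sH] := sf x.
  have dH : is_derive x a H (al *: a).
    by have := smooth_lift_is_derive a sH; rewrite -(derivative_mapE a sf sH) df.
  have : is_derive x a (H + cst (G x - H x)) (al *: a).
    by have := is_deriveD dH (is_derive_cst (G x - H x) x a); rewrite addr0.
  apply: near_eq_is_derive.
  have q0 : (0 : R) < 2^-1 by rewrite invr_gt0.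
  have [r r0 Hr] := smooth_lift_ball sH q0.
  apply/nbhs_ballP; exists (Num.min d r); first by rewrite /= lt_min d0.
  move=> y; rewrite -ball_normE/= distrC lt_min => /andP[/Gd[g1 g2] /Hr[]].
  rewrite subrK => h1 h2.
  have [|_ Hx] := Hr 0; first by rewrite normr0.
  rewrite add0r in Hx.
  apply: (@toT_small_inj R n).
    rewrite -[(H + _) y]/(H y + (G x - H x)) toTD toTB h2 Hx -/phi g2 toTB.
    rewrite [phi _ + _]addrC -addrA.
    by rewrite [phi x + _]addrCA subrr addr0 subrK.
  have -> : (H + cst (G x - H x)) y - G y = (H y - H x) - (G y - G x).
    by rewrite /= opprB [RHS]addrACA !addrA.
  by rewrite (le_lt_trans (ler_normB _ _))//; lra.
pose x := repr p; rewrite -[p]toT_repr -/x -toTD.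
pose W (s : R) := G (x + s *: a).
have dW (s : R^o) : is_derive s 1 W (al *: a).
  apply: is_derive_increments (dG (x + s *: a)) => h.
  by rewrite /W [h *: 1]mulr1 scalerDl addrCA.
suff WE : W t - (t * al) *: a = W 0.
  rewrite -[LHS]/(phi _) -[f (toT x)]/(phi _) [LHS]phiG (phiG x) -addrA; congr (_ + _).
  by move/eqP : WE; rewrite subr_eq /W scale0r addr0 => /eqP ->; rewrite toTD.
apply/rowP => i; pose Wi (s : R) := (W s - (s * al) *: a) 0 i.
have -> : W 0 0 i = Wi 0 by rewrite /Wi mul0r scale0r subr0.
apply: (@is_derive_0_is_cst R Wi) => s.
have [dWs Ws] := dW s.
have dWi : is_derive (s : R^o) 1 (fun s => W s 0 i) (al * a 0 i).
  apply: DeriveDef; first exact: (proj1 (derivable_mxP _ _ _) dWs 0 i).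
  by have := derive_mx dWs; rewrite Ws => /rowP/(_ i); rewrite !mxE => ->.
have -> : Wi = (fun s => W s 0 i) - (fun s : R => s * (al * a 0 i)).
  by apply/funext => u; rewrite -[RHS]/(W u 0 i - u * (al * a 0 i)) mulrA /Wi !mxE.
have dl : is_derive (s : R^o) 1 (fun s : R => s * (al * a 0 i)) (al * a 0 i).
  have := is_deriveZ (al * a 0 i) (is_derive_id (s : R^o) 1).
  rewrite [_ *: 1]mulr1.
  suff -> : (fun s : R => s * (al * a 0 i)) = ((al * a 0 i) *: id : R^o -> R^o) by [].
  by apply/funext => u; rewrite mulrC.
by have := is_deriveB dWi dl; rewrite subrr.
Qed.

End LocalLifts.

(** * Integer matrices acting on the torus, and the multiplier group *)

Section LinearDiffeo.
Variables (R : realType) (n : nat).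
Local Notation toT := (@toT R n).

Lemma mulmxr_continuous (B : 'M[R]_n) : continuous (mulmxr B : 'rV[R]_n -> 'rV[R]_n).
Proof.
apply: bounded_linear_continuous.
exists (\sum_i \sum_j `|B i j|); split; first by rewrite num_real.
move=> M BM; apply/nbhs_ballP; exists 1 => [|x]; first by rewrite /= ltr01.
rewrite -ball_normE/= sub0r normrN => x1.
rewrite (le_trans (norm_mulmx_le _ _))// (le_trans _ (ltW BM))// ler_piMl ?(ltW x1)//.
by rewrite sumr_ge0// => i _; rewrite sumr_ge0.
Qed.

Lemma smooth_on_cst (V W : normedModType R) (U : set V) (c : W) :
  smooth_on U (cst c : V -> W).
Proof.
move=> k; elim: k c => [|k IH] c /=; first by move=> x _; exact: cvg_cst.
split=> [x _|v]; first exact: differentiable_cst.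
have -> : (fun x => 'd (cst c) x v) = cst (0 : W); last exact: IH.
by apply/funext => x; rewrite diff_cst.
Qed.

(** The differential is the same at every point, so only constant maps remain after one
    differentiation. *)
Lemma smooth_on_linear (V W : normedModType R) (U : set V) (f : {linear V -> W}) :
  continuous f -> smooth_on U f.
Proof.
move=> cf [|k] /=; first by move=> x _; exact: cf.
split=> [x _|v]; first exact: linear_differentiable.
have -> : (fun x => 'd f x v) = cst (f v); last exact: smooth_on_cst.
by apply/funext => x; rewrite diff_lin.
Qed.

(** Computed on the chosen representative; for integer [B] the choice is immaterial. *)
Definition torus_linear (B : 'M[R]_n) (p : torus R n) : torus R n := toT (repr p *m B).

Lemma torus_linear_toT B x : B \is a mxOver Num.int ->
  torus_linear B (toT x) = toT (x *m B).
Proof.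
move=> BZ; apply/toT_eq; rewrite -mulmxBl mxOverM//.
by apply/toT_eq; rewrite toT_repr.
Qed.

Lemma torus_linear_lift B x : B \is a mxOver Num.int ->
  smooth_lift (torus_linear B \o toT) x (mulmxr B).
Proof.
move=> BZ; exists setT; split.
- by split; first exact: openT.
- by apply: smooth_on_linear; exact: mulmxr_continuous.
- by move=> y _ /=; rewrite torus_linear_toT.
Qed.

Lemma torus_linear_smooth B : B \is a mxOver Num.int -> smooth_map (torus_linear B).
Proof. by move=> BZ x; exists (mulmxr B); exact: torus_linear_lift. Qed.

Lemma torus_linear_derivative B p v : B \is a mxOver Num.int ->
  derivative_map (torus_linear B) p v = v *m B.
Proof.
move=> BZ; rewrite -[p]toT_repr.
rewrite (derivative_mapE v (torus_linear_smooth BZ) (torus_linear_lift (repr p) BZ)).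
by rewrite diff_lin//; exact: mulmxr_continuous.
Qed.

Lemma torus_linearK B C : B \is a mxOver Num.int -> C \is a mxOver Num.int ->
  B *m C = 1%:M -> cancel (torus_linear B) (torus_linear C).
Proof.
move=> BZ CZ BC p; rewrite [torus_linear B p]/torus_linear torus_linear_toT//.
by rewrite -mulmxA BC mulmx1 toT_repr.
Qed.

Lemma multiplierP (psi : R -> torus R n -> torus R n) (f : diffeo R n) :
  symmetry_group psi f -> multiplier psi f != 0 /\
  forall p, Defs.pushforward f (generator psi) p = multiplier psi f *: generator psi p.
Proof.
move=> [al fal].
by apply: (@xgetPex _ 0 [set alpha : R | alpha != 0 /\ forall p,
  Defs.pushforward f (generator psi) p = alpha *: generator psi p]); exists al.
Qed.

Lemma multiplier_groupP (psi : R -> torus R n -> torus R n) (a : 'rV[R]_n) (al : R) :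
  (forall p, generator psi p = a) -> a != 0 -> rat_free (fun i => a 0 i) ->
  multiplier_group psi al <->
  [/\ al != 0, exists2 B : 'M[R]_n, B \is a mxOver Num.int & al *: a = a *m B &
      exists2 B : 'M[R]_n, B \is a mxOver Num.int & al^-1 *: a = a *m B].
Proof.
move=> psia a0 afree.
have scal_inj (b c : R) : b *: a = c *: a -> b = c.
  move/eqP; rewrite -subr_eq0 -scalerBl scaler_eq0 (negPf a0) orbF subr_eq0.
  by move/eqP.
split.
- move=> [f sf <-].
  have [m0 mf] := multiplierP sf.
  move: (multiplier psi f) m0 mf => {}al al0 mf.
  have df p : derivative_map f p a = al *: a.
    by have := mf (f p); rewrite /Defs.pushforward diffeo_funK !psia.
  have conj := flow_conjugacy (smooth_diffeo_fun f) df.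
  have perT (h : torus R n -> torus R n) : lattice_periodic (h \o toT).
    by move=> x k /toT_eq0 k0 /=; rewrite toTD k0 addr0.
  split => //.
    apply: (@multiplier_matrix R n (f \o toT)) => //.
      exact: (smooth_to_torus_continuous (smooth_diffeo_fun f)).
    by move=> t /=; rewrite toT0 -conj add0r.
  apply: (@multiplier_matrix R n (diffeo_inv f \o toT)) => //.
    exact: (smooth_to_torus_continuous (smooth_diffeo_inv f)).
  (* Applying [f] to both sides reduces the relation for the inverse to that for [f] at time
     [t / al]. *)
  move=> t /=; apply: (can_inj (diffeo_funK f)).
  by rewrite diffeo_invK conj diffeo_invK toT0 add0r divfK.
- move=> [al0 [B BZ aB] [C CZ aC]].
  (* Each column of [D] is a rational relation between the components of [a]. Applied to
     [B *m C - 1], this makes [B] and [C] inverse to each other. *)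
  have int_rel (D : 'M[R]_n) : D \is a mxOver Num.int -> a *m D = 0 -> D = 0.
    move=> /mxOverP DZ aD; apply/matrixP => i j; rewrite mxE.
    have DE k : D k j = ratr (Num.floor (D k j))%:~R :> R.
      by rewrite ratr_int; apply/esym/eqP; rewrite -intrEfloor DZ.
    rewrite DE (afree (fun k => (Num.floor (D k j))%:~R)) ?rmorph0//.
    have : (a *m D) 0 j = 0 by rewrite aD mxE.
    by rewrite mxE => aDj; rewrite -[RHS]aDj; apply: eq_bigr => k _; rewrite -DE mulrC.
  have BC : B *m C = 1%:M.
    apply/subr0_eq/int_rel.
      have /mxOverP BCZ : B *m C \is a mxOver Num.int by exact: mxOverM.
      by apply/mxOverP => i j; rewrite mxE rpredD// mxE rpredN mxE; exact: natr_int.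
    by rewrite mulmxBr mulmx1 mulmxA -aB -scalemxAl -aC scalerA divff// scale1r subrr.
  have CB : C *m B = 1%:M by exact: mulmx1C.
  pose f := Diffeo (torus_linearK BZ CZ BC) (torus_linearK CZ BZ CB)
              (torus_linear_smooth BZ) (torus_linear_smooth CZ).
  have ff p : Defs.pushforward f (generator psi) p = al *: generator psi p.
    by rewrite /Defs.pushforward !psia torus_linear_derivative.
  have sf : symmetry_group psi f by exists al.
  exists f => //; have [_ /(_ 0)] := multiplierP sf.
  by rewrite ff !psia => /scal_inj.
Qed.

End LinearDiffeo.

(** * Orders in number fields *)

Lemma eigenvector_horner (K : comNzRingType) (n : nat) (A : 'M[K]_n.+1)
    (v : 'rV[K]_n.+1) (c : K) (p : {poly K}) :
  v *m A = c *: v -> v *m horner_mx A p = p.[c] *: v.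
Proof.
move=> vA; elim/poly_ind: p => [|p d IH].
  by rewrite rmorph0 mulmx0 horner0 scale0r.
rewrite rmorphD rmorphM /= horner_mx_X horner_mx_C mulmxDr mulmxA IH -scalemxAl vA.
by rewrite scalerA mul_mx_scalar hornerMXaddC scalerDl.
Qed.

Lemma mxOver_intP (K : archiNumDomainType) m n (B : 'M[K]_(m, n)) :
  reflect (exists Z : 'M[int]_(m, n), B = map_mx intr Z) (B \is a mxOver Num.int).
Proof.
apply: (iffP mxOverP) => [BZ|[Z ->] i j]; last by rewrite mxE intr_int.
exists (map_mx Num.floor B); apply/matrixP => i j; rewrite !mxE.
by apply/esym/eqP; rewrite -intrEfloor BZ.
Qed.

(** [c] is a root of the characteristic polynomial, which is monic with integer coefficients. *)
Lemma integral_eigenvalue (K : archiNumFieldType) (n : nat) (Z : 'M[K]_n) (v : 'rV[K]_n)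
    (c : K) :
  Z \is a mxOver Num.int -> v != 0 -> v *m Z = c *: v ->
  integralOver (intr : int -> K) c.
Proof.
move=> /mxOver_intP[{}Z ->] v0 vZ; exists (char_poly Z); first exact: char_poly_monic.
rewrite map_char_poly -eigenvalue_root_char; apply/eigenvalueP.
by exists v.
Qed.

Lemma ratr_int_inj (K : archiNumFieldType) (q : rat) :
  (ratr q : K) \is a Num.int -> q \is a Num.int.
Proof. by move=> /intrP[z]; rewrite -ratr_int => /fmorph_inj ->; exact: intr_int. Qed.

(* The eigenvalues of [A] are roots of [p], hence algebraic integers. *)
Lemma integral_trace (n : nat) (A : 'M[rat]_n.+1) (p : {poly int}) :
  p \is monic -> horner_mx A (map_poly intr p) = 0 -> \tr A \is a Num.int.
Proof.
move=> pm pA; apply: (@ratr_int_inj algC).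
(* A rational algebraic integer is an integer, so it is enough to write the trace as a sum of
   algebraic integers. *)
apply: Cint_rat_Aint; first by apply/CratP; exists (\tr A).
pose A' := map_mx ratr A : 'M[algC]_n.+1.
have -> : ratr (\tr A) = \tr A' :> algC.
  by rewrite /mxtrace rmorph_sum; apply: eq_bigr => i _; rewrite mxE.
have pA' : horner_mx A' (map_poly intr p) = 0.
  have := congr1 (map_mx (ratr : rat -> algC)) pA.
  rewrite map_horner_mx map_mx0 -map_poly_comp => <-; congr (horner_mx _ _).
  by apply: eq_map_poly => z /=; rewrite ratr_int.
have [r rE] := closed_field_poly_normal (char_poly A').
rewrite (monicP (char_poly_monic A')) scale1r in rE.
have sr : size r = n.+1.
  by apply/eqP; rewrite -eqSS -(size_prod_XsubC r id) -rE size_char_poly.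
have := char_poly_trace A' (ltn0Sn n); rewrite rE.
have := @coefPn_prod_XsubC _ r; rewrite sr => /(_ isT) -> /oppr_inj <-.
rewrite big_seq rpred_sum// => z zr.
have : eigenvalue A' z by rewrite eigenvalue_root_char rE root_prod_XsubC.
move=> /eigenvalueP[v vA v0].
have := eigenvector_horner (map_poly intr p) vA.
rewrite pA' mulmx0 => /esym/eqP; rewrite scaler_eq0 (negPf v0) orbF => pz.
apply: (root_monic_Aint pz); first exact: monic_map.
by apply/polyOverP => i; rewrite coef_map intr_int.
Qed.

Lemma common_denominator (I : finType) (q : I -> rat) :
  exists2 d : rat, d != 0 & (d \is a Num.int) /\ forall i, d * q i \is a Num.int.
Proof.
exists (\prod_i (denq (q i))%:~R).
  by apply/prodf_neq0 => i _; rewrite intr_eq0 denq_neq0.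
split; first by apply: rpred_prod => i _; exact: intr_int.
move=> i; rewrite (bigD1 i)//= mulrAC [_ * q i]mulrC -numqE.
by rewrite rpredM ?intr_int// rpred_prod// => j _; exact: intr_int.
Qed.

(** * Multiplication matrices and the trace form *)

Section NumberField.
Variables (R : realType) (n : nat) (F : divringClosed R).
Local Notation "A ^Q" := (map_mx (ratr : rat -> R) A) (at level 2, format "A ^Q").
Local Notation integral := (integralOver (intr : int -> R)).
Implicit Types (b : 'rV[R]_n.+1) (x y u : R) (A B : 'M[rat]_n.+1).

(** Column [j] of [A] holds rational coordinates of [x * b 0 j]; for a basis [b] of [F] this is the
    matrix of multiplication by [x]. *)
Definition mult_matrix b x A := x *: b = b *m A^Q.

Lemma mult_matrixM b x y A B :
  mult_matrix b x A -> mult_matrix b y B -> mult_matrix b (x * y) (A *m B).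
Proof.
by move=> xA yB; rewrite /mult_matrix map_mxM mulmxA -xA -scalemxAl -yB scalerA.
Qed.

Lemma mult_matrixZ b x A (q : rat) :
  mult_matrix b x A -> mult_matrix b (ratr q * x) (q *: A).
Proof. by move=> xA; rewrite /mult_matrix map_mxZ -scalemxAr -xA scalerA. Qed.

Lemma mult_matrix_sum b (I : finType) (x : I -> R) (A : I -> 'M[rat]_n.+1) :
  (forall i, mult_matrix b (x i) (A i)) -> mult_matrix b (\sum_i x i) (\sum_i A i).
Proof.
move=> xA; elim/big_ind2: _ => [|y B z C yB zC|i _]; last exact: xA.
  by rewrite /mult_matrix scale0r map_mx0 mulmx0.
by rewrite /mult_matrix map_mxD mulmxDr scalerDl yB zC.
Qed.

Lemma mult_matrix1 b : mult_matrix b 1 1%:M.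
Proof. by rewrite /mult_matrix map_mx1 mulmx1 scale1r. Qed.

Lemma mult_matrix_scale b (c x : R) A : mult_matrix b x A -> mult_matrix (c *: b) x A.
Proof. by move=> xA; rewrite /mult_matrix scalerA mulrC -scalerA xA scalemxAl. Qed.

Variable b : 'rV[R]_n.+1.
Hypothesis hb : rat_basis F (fun i => b 0 i).

Lemma basis_free A : b *m A^Q = 0 -> A = 0.
Proof.
move=> bA; apply/matrixP => i j; rewrite mxE.
have [_ bfree _] := hb; apply: (bfree (fun i => A i j)).
have /rowP/(_ j) := bA; rewrite !mxE => bAj; rewrite -[RHS]bAj.
by apply: eq_bigr => k _; rewrite mxE mulrC.
Qed.

Lemma basis_neq0 : b != 0.
Proof.
apply/eqP => b0; have /matrixP/(_ 0 0) : (1%:M : 'M[rat]_n.+1) = 0.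
  by apply: basis_free; rewrite b0 mul0mx.
by rewrite !mxE eqxx => /eqP; rewrite oner_eq0.
Qed.

Lemma mult_matrix_inj x A B : mult_matrix b x A -> mult_matrix b x B -> A = B.
Proof.
move=> xA xB; apply/subr0_eq/basis_free.
by rewrite map_mxB mulmxBr -xA -xB subrr.
Qed.

Lemma mult_matrix_ex x : x \in F -> exists A, mult_matrix b x A.
Proof.
move=> xF; have [bF _ bgen] := hb.
have /choice[q qE] j : exists q : 'I_n.+1 -> rat, x * b 0 j = \sum_i ratr (q i) * b 0 i.
  by apply: bgen; rewrite rpredM.
exists (\matrix_(i, j) q j i); apply/rowP => j; rewrite !mxE qE.
by apply: eq_bigr => i _; rewrite !mxE mulrC.
Qed.

Lemma basis_expand x : x \in F ->
  exists q : 'I_n.+1 -> rat, x = \sum_i ratr (q i) * b 0 i.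
Proof. by case: hb => _ _; exact. Qed.

Lemma mult_matrix_integral x A :
  mult_matrix b x A -> A \is a mxOver Num.int -> integral x.
Proof.
move=> xA /mxOver_intP[Z AZ].
apply: (@integral_eigenvalue _ _ A^Q b); last exact/esym/xA.
  by apply/mxOverP => i j; rewrite AZ !mxE ratr_int intr_int.
exact: basis_neq0.
Qed.

(** A monic integer polynomial killing [x] also kills [A]: its value at [A] sends [b] to 0, and the
    basis is free. *)
Lemma mult_matrix_trace x A : mult_matrix b x A -> integral x -> \tr A \is a Num.int.
Proof.
move=> xA [p pm px]; apply: (integral_trace pm); apply: basis_free.
rewrite map_horner_mx -map_poly_comp.
rewrite (@eq_map_poly _ _ _ (intr : int -> R)) => [|z /=]; last exact: ratr_int.
by rewrite (@eigenvector_horner _ _ _ _ x) ?(rootP px) ?scale0r.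
Qed.

(* The Gram matrix [T] of the trace form is an invertible integer matrix, and
   [T *m A] is an integer matrix too; [d] is the determinant of [T]. *)
Lemma integral_basis_denominator : (forall i, integral (b 0 i)) ->
  exists2 d : rat, d != 0 & d \is a Num.int /\
    forall u A, integral u -> mult_matrix b u A -> d *: A \is a mxOver Num.int.
Proof.
move=> bint; have [bF _ _] := hb.
have /choice[C CE] i : exists A, mult_matrix b (b 0 i) A by exact/mult_matrix_ex.
pose T : 'M[rat]_n.+1 := \matrix_(i, k) \tr (C i *m C k).
have TZ : T \is a mxOver Num.int.
  apply/mxOverP => i k; rewrite mxE.
  apply: (mult_matrix_trace (mult_matrixM (CE i) (CE k))).
  exact: (integral_mul (bint i) (bint k)).
(* A kernel vector gives a nonzero [x] in [F] orthogonal to all [b 0 k] for the trace form, hence to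
   [x^-1]; but the trace of [x * x^-1 = 1] is [n.+1]. *)
have T0 : \det T != 0.
  apply/negP => /eqP/eqP/det0P[v v0 vT].
  pose x := \sum_i ratr (v 0 i) * b 0 i.
  pose X := \sum_i v 0 i *: C i.
  have xX : mult_matrix b x X by apply: mult_matrix_sum => i; exact: mult_matrixZ.
  have xF : x \in F.
    by apply: rpred_sum => i _; rewrite rpredM// rpred_rat.
  have x0 : x != 0.
    apply: contra v0 => /eqP x0; apply/eqP/rowP => i; rewrite mxE.
    by have [_ bfree _] := hb; exact: (bfree _ x0).
  have trXC k : \tr (X *m C k) = 0.
    rewrite mulmx_suml raddf_sum /=.
    have /rowP/(_ k) := vT; rewrite !mxE => vTk; rewrite -[RHS]vTk.
    by apply: eq_bigr => i _; rewrite mxE -scalemxAl mxtraceZ.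
  have [w wE] : exists w : 'I_n.+1 -> rat, x^-1 = \sum_i ratr (w i) * b 0 i.
    by apply: basis_expand; rewrite rpredVr.
  have xY : mult_matrix b x^-1 (\sum_k w k *: C k).
    by rewrite wE; apply: mult_matrix_sum => k; exact: mult_matrixZ.
  have := mult_matrixM xX xY; rewrite divff// => /(mult_matrix_inj (mult_matrix1 b)) E.
  have := mxtrace1 rat n.+1; rewrite E mulmx_sumr raddf_sum /= big1 => [/esym/eqP|k _].
    by rewrite pnatr_eq0.
  by rewrite -scalemxAr mxtraceZ trXC mulr0.
exists (\det T) => //; split.
  by have /mxOver_intP[Z ->] := TZ; rewrite det_map_mx intr_int.
move=> u A ui uA.
(* Its entries are the traces of the integral elements [b 0 k * (u * b 0 j)]. *)
have TA : T *m A \is a mxOver Num.int.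
  apply/mxOverP => k j.
  have CA : A *m C j = \sum_i A i j *: C i.
    apply: (@mult_matrix_inj (u * b 0 j)); first exact: mult_matrixM.
    have -> : u * b 0 j = \sum_i ratr (A i j) * b 0 i.
      have /rowP/(_ j) := uA; rewrite !mxE => ->.
      by apply: eq_bigr => i _; rewrite mxE mulrC.
    by apply: mult_matrix_sum => i; exact: mult_matrixZ.
  have -> : (T *m A) k j = \tr (C k *m (A *m C j)).
    rewrite CA mulmx_sumr raddf_sum mxE; apply: eq_bigr => i _.
    by rewrite mxE -scalemxAr /= mxtraceZ mulrC.
  apply: (mult_matrix_trace (mult_matrixM (CE k) (mult_matrixM uA (CE j)))).
  exact: (integral_mul (bint k) (integral_mul ui (bint j))).
have -> : \det T *: A = \adj T *m (T *m A).
  by rewrite mulmxA mul_adj_mx mul_scalar_mx.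
apply: mxOverM TA.
have /mxOver_intP[Z ->] := TZ; rewrite -map_mx_adj.
by apply/mxOver_intP; exists (\adj Z).
Qed.

End NumberField.

(** One representative for each key that occurs already produces all values of [h]. *)
Lemma finite_image_key (S : pointedType) (K : finType) (T : Type) (U : set S)
    (key : S -> K) (h : S -> T) :
  (forall u v, U u -> U v -> key u = key v -> h u = h v) -> finite_set (h @` U).
Proof.
move=> hkey; pose r k := xget point [set u | U u /\ key u = k].
apply: (@sub_finite_set _ _ ((h \o r) @` [set: K])); last first.
  by apply: finite_image; exact: finite_finset.
move=> _ [u Uu <-]; exists (key u) => //=.
have [Ur kr] : U (r (key u)) /\ key (r (key u)) = key u.
  by apply: (@xgetPex _ _ [set v | U v /\ key v = key u]); exists u.
exact: hkey.
Qed.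

(** * The stabilizer of a lattice has finite index in the units *)

Section FiniteIndex.
Variables (R : realType) (n : nat) (F : divringClosed R).
Local Notation "A ^Q" := (map_mx (ratr : rat -> R) A) (at level 2, format "A ^Q").
Local Notation integral := (integralOver (intr : int -> R)).

Lemma rat_basis_scale m (c : R) (b : 'I_m -> R) : c \in F -> c != 0 ->
  rat_basis F b -> rat_basis F (fun i => c * b i).
Proof.
move=> cF c0 [bF bfree bgen]; split=> [i|q qb|x xF]; first by rewrite rpredM.
  apply: bfree; apply: (mulfI c0); rewrite mulr0 mulr_sumr -[RHS]qb.
  by apply: eq_bigr => i _; rewrite mulrCA.
have [q qE] : exists q : 'I_m -> rat, x / c = \sum_i ratr (q i) * b i.
  by apply: bgen; rewrite rpredM// rpredV.
exists q; rewrite -[x](divfK c0) qE mulr_suml.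
by apply: eq_bigr => i _; rewrite mulrAC mulrA.
Qed.

Variable b : 'rV[R]_n.+1.
Hypothesis hb : rat_basis F (fun i => b 0 i).

(** Multiplying the basis by a common denominator [e] of its multiplication matrices makes it
    integral, and rescaling a basis leaves multiplication matrices unchanged. *)
Lemma integers_denominator :
  exists2 d : rat, d != 0 & d \is a Num.int /\
    forall u A, integral u -> mult_matrix b u A -> d *: A \is a mxOver Num.int.
Proof.
have [bF _ _] := hb.
have /choice[C CE] i : exists A, mult_matrix b (b 0 i) A by exact/(mult_matrix_ex hb).
have [e e0 [eZ eC]] := common_denominator
  (fun ijk : 'I_n.+1 * 'I_n.+1 * 'I_n.+1 => C ijk.1.1 ijk.1.2 ijk.2).
have e0' : ratr e != 0 :> R by rewrite fmorph_eq0.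
have hc : rat_basis F (fun i => (ratr e *: b) 0 i).
  have := rat_basis_scale (rpred_rat F e) e0' hb.
  by congr (rat_basis _ _); apply/funext => i; rewrite mxE.
have [i|d d0 [dZ dA]] := integral_basis_denominator hc.
  rewrite mxE; apply: (mult_matrix_integral hb (mult_matrixZ e (CE i))).
  by apply/mxOverP => j k; rewrite mxE; exact: (eC (i, j, k)).
by exists d => //; split => // u A ui /(mult_matrix_scale (ratr e)); exact: dA.
Qed.

(** For a basis [b] of [F], the units of the order formed by the multipliers of the lattice spanned
    by [b]. *)
Definition lattice_stabilizer : set R :=
  [set x | [/\ x != 0,
    exists2 A : 'M[rat]_n.+1, A \is a mxOver Num.int & mult_matrix b x A &
    exists2 A : 'M[rat]_n.+1, A \is a mxOver Num.int & mult_matrix b x^-1 A]].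

Lemma lattice_stabilizer_div x y :
  lattice_stabilizer x -> lattice_stabilizer y -> lattice_stabilizer (x / y).
Proof.
move=> [x0 [A AZ xA] [A' AZ' xA']] [y0 [B BZ yB] [B' BZ' yB']]; split.
- by rewrite mulf_neq0// invr_eq0.
- by exists (A *m B'); [exact: mxOverM|exact: mult_matrixM].
- exists (B *m A'); first exact: mxOverM.
  by rewrite invfM invrK mulrC; exact: mult_matrixM.
Qed.

Lemma lattice_stabilizer1 : lattice_stabilizer 1.
Proof.
have Z1 : (1%:M : 'M[rat]_n.+1) \is a mxOver Num.int.
  by apply/mxOverP => i j; rewrite mxE; exact: natr_int.
have M1 := mult_matrix1 b.
by split; [exact: oner_neq0|exists 1%:M|exists 1%:M; rewrite ?invr1].
Qed.

Lemma mult_matrix_int_ring_of_integers x (A : 'M[rat]_n.+1) :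
  A \is a mxOver Num.int -> mult_matrix b x A -> ring_of_integers F x.
Proof.
move=> AZ xA; split; last exact: (mult_matrix_integral hb xA).
have [bF _ _] := hb.
have /rV0Pn[i bi0] := basis_neq0 hb.
(* [x] lies in [F] as the quotient of [x * b 0 i], a rational combination of the basis, by
   [b 0 i]. *)
rewrite -[x](mulfK bi0) rpredM ?rpredV//.
have /rowP/(_ i) := xA; rewrite !mxE => ->.
by apply: rpred_sum => j _; rewrite mxE rpredM// rpred_rat.
Qed.

(** With [V] the matrix of [v^-1], one has [A *m V = 1 + W *m (d *: V)], and [d] clears the
    denominators of [V] because [v^-1] is integral. *)
Lemma unit_quotient_int (d : rat) u v (A B : 'M[rat]_n.+1) (W : 'M[rat]_n.+1) :
  d != 0 ->
  (forall u A, integral u -> mult_matrix b u A -> d *: A \is a mxOver Num.int) ->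
  integral v^-1 -> v \in F -> v != 0 ->
  mult_matrix b u A -> mult_matrix b v B -> A - B = d *: W -> W \is a mxOver Num.int ->
  exists2 C : 'M[rat]_n.+1, C \is a mxOver Num.int & mult_matrix b (u / v) C.
Proof.
move=> d0 dA vi vF v0 uA vB AB WZ.
have [V vV] : exists V, mult_matrix b v^-1 V.
  by apply: (mult_matrix_ex hb); rewrite rpredV.
exists (A *m V); last exact: mult_matrixM.
have BV : B *m V = 1%:M.
  apply: (mult_matrix_inj hb (mult_matrixM vB vV)).
  by rewrite divff//; exact: mult_matrix1.
have -> : A *m V = 1%:M + W *m (d *: V).
  by rewrite -scalemxAr scalemxAl -AB mulmxBl BV addrC subrK.
have /mxOverP H := mxOverM WZ (dA _ _ vi vV).
by apply/mxOverP => i j; rewrite mxE rpredD// mxE; exact: natr_int.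
Qed.

Lemma lattice_stabilizer_finite_index :
  finite_index_subgroup lattice_stabilizer (unit_group (ring_of_integers F)).
Proof.
split.
- move=> x [x0 [A AZ xA] [A' AZ' xA']]; split.
    exact: mult_matrix_int_ring_of_integers xA.
  by exists x^-1; [exact: mult_matrix_int_ring_of_integers xA'|rewrite divff].
- exact: lattice_stabilizer1.
- exact: lattice_stabilizer_div.
have [d d0 [/intrP[z dz] dA]] := integers_denominator.
have z0 : z != 0 by move: d0; rewrite dz intr_eq0.
(* One factor of [d] is spent in passing from [A] to [d *: A]; the other absorbs the denominators of
   the inverse unit. *)
pose N := (z * z)%R.
have N0 : N != 0 by rewrite mulf_neq0.
set U := unit_group _.
have UP u : U u -> [/\ u \in F, u != 0, integral u & integral u^-1].
  move=> [[uF ui] [y [yF yi] uy]].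
  have u0 : u != 0.
    by apply/eqP => u0; move/eqP: uy; rewrite u0 mul0r eq_sym oner_eq0.
  split => //; suff -> : u^-1 = y by [].
  by apply: (mulfI u0); rewrite divff.
have /choice[Z ZE] u : exists Z : 'M[int]_n.+1, U u ->
    exists2 A, mult_matrix b u A & d *: A = map_mx intr Z.
  have [/UP[uF u0 ui _]|nU] := pselect (U u); last by exists 0.
  have [A uA] := mult_matrix_ex hb uF.
  have /mxOver_intP[Z ZE] := dA _ _ ui uA.
  by exists Z => _; exists A.
(* The residues lie below the absolute value of [N]; the successor only provides the nonempty
   ordinal type needed by [inord]. *)
pose key u : 'M['I_(`|N|%N).+1]_n.+1 := map_mx (fun t => inord `|(t %% N)%Z|%N) (Z u).
have keyE u v : key u = key v -> exists W : 'M[int]_n.+1, Z u - Z v = N *: W.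
  move=> /matrixP uv; exists (\matrix_(i, j) ((Z u i j - Z v i j) %/ N)%Z).
  apply/matrixP => i j; rewrite !mxE mulrC divzK//.
  have := congr1 val (uv i j); rewrite !mxE /= !inordK; last 2 first.
  - by rewrite ltnS -lez_nat gez0_abs ?modz_ge0// ltW// ltz_mod.
  - by rewrite ltnS -lez_nat gez0_abs ?modz_ge0// ltW// ltz_mod.
  move=> E; have {}E : (Z u i j %% N)%Z = (Z v i j %% N)%Z.
    by rewrite -[LHS]gez0_abs ?modz_ge0// E gez0_abs ?modz_ge0.
  by rewrite -eqz_mod_dvd E.
have quot u v : U u -> U v -> key u = key v ->
    exists2 C : 'M[rat]_n.+1, C \is a mxOver Num.int & mult_matrix b (u / v) C.
  move=> Uu Uv /keyE[W WE].
  have [A uA AZ] := ZE u Uu; have [B vB BZ] := ZE v Uv.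
  have [vF v0 _ vi] := UP v Uv.
  apply: (unit_quotient_int d0 dA vi vF v0 uA vB (W := map_mx intr W)); last first.
    by apply/mxOver_intP; exists W.
  apply: (scalerI d0); rewrite scalerBr AZ BZ -map_mxB WE map_mxZ scalerA.
  by rewrite dz rmorphM.
apply: (@finite_image_key _ _ _ U key) => u v Uu Uv uv.
(* Equal keys make both [u' / v'] and its inverse preserve the lattice, so the cosets coincide; by
   symmetry one inclusion is enough. *)
have sub u' v' : U u' -> U v' -> key u' = key v' ->
    [set u' * m | m in lattice_stabilizer] `<=` [set v' * m | m in lattice_stabilizer].
  move=> Uu' Uv' uv' _ [m mM <-].
  have [_ u0 _ _] := UP _ Uu'; have [_ v0 _ _] := UP _ Uv'.
  exists (u' / v' * m); last by rewrite mulrA mulrCA divff// mulr1.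
  have vu : lattice_stabilizer (v' / u').
    split; first by rewrite mulf_neq0// invr_eq0.
      exact: quot.
    by rewrite invfM invrK mulrC; exact: quot.
  have := lattice_stabilizer_div mM vu; rewrite invfM invrK.
  by congr lattice_stabilizer; rewrite mulrC [_^-1 * _]mulrC.
by apply/seteqP; split; exact: sub.
Qed.

End FiniteIndex.

Unset Implicit Arguments.

Theorem theorem3p3 (R : realType) (n : nat) (hn : (2 <= n)%N)
    (F : divringClosed R) (hF : has_degree F n)
    (psi : R -> torus R n -> torus R n) (hpsi : quasiperiodic psi) :
  algebraic_flow F psi ->
  finite_index_subgroup (multiplier_group psi)
    (unit_group (ring_of_integers F)).
Proof.
case: n hn hF psi hpsi => // n _ _ psi _ [a [psia [th [th0 hb']]]].
pose b := th *: a.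
have hb : rat_basis F (fun i => b 0 i).
  by move: hb'; congr (rat_basis _ _); apply/funext => i; rewrite mxE.
have a0 : a != 0.
  by have := basis_neq0 hb; rewrite scaler_eq0 negb_or => /andP[].
have afree : rat_free (fun i => a 0 i).
  move=> q qa; have [_ bfree _] := hb; apply: bfree.
  transitivity (th * \sum_i ratr (q i) * a 0 i); last by rewrite qa mulr0.
  by rewrite mulr_sumr; apply: eq_bigr => i _; rewrite mxE mulrCA.
suff -> : multiplier_group psi = lattice_stabilizer b.
  exact: lattice_stabilizer_finite_index.
(* Rescaling by [th] does not affect the matrix relation, and integer matrices are the same over the
   reals and the rationals. *)
have aP x : (exists2 B : 'M[R]_n.+1, B \is a mxOver Num.int & x *: a = a *m B) <->
    exists2 A : 'M[rat]_n.+1, A \is a mxOver Num.int & mult_matrix b x A.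
  have QZ (Z : 'M[int]_n.+1) : map_mx (ratr : rat -> R) (map_mx intr Z) = map_mx intr Z.
    by apply/matrixP => i j; rewrite !mxE ratr_int.
  split=> [[B /mxOver_intP[Z ->] aB]|[A /mxOver_intP[Z ->] bA]];
      exists (map_mx intr Z); do ?by apply/mxOver_intP; exists Z.
    by rewrite /mult_matrix QZ -scalemxAl -aB !scalerA mulrC.
  by apply: (scalerI th0); rewrite scalemxAl -QZ -[th *: a]/b -bA /b !scalerA mulrC.
apply/seteqP; split => x.
  by move/(multiplier_groupP x psia a0 afree) => [x0 /aP h1 /aP h2].
by move=> [x0 /aP h1 /aP h2]; apply/(multiplier_groupP x psia a0 afree).
Qed.
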